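(* Let $\mathcal{P}\subset\Delta(\mathcal{S})^{\mathcal{S}\times\mathcal{A}}$ be a nonempty compact convex uncertainty set that is weakly s-tractable. Let $r\in\mathbb{R}^{\mathcal{S}\times\mathcal{A}}$ and $\gamma\in(0,1)$. Then for every $\mu\in\Delta(\mathcal{S})$ there exists a stationary optimal policy: $$\sup_{\pi\in\Pi_{\mathsf H}}\inf_{P\in\mathcal{P}}\mu^\top v^{\pi,P}=\max_{\pi\in\Pi_{\mathsf S}}\min_{P\in\mathcal{P}}\mu^\top v^{\pi,P}.$$ Additionally, there exists a stationary policy $\pi^\star\in\Pi_{\mathsf S}$ which is optimal (i.e. attains the supremum over $\Pi_{\mathsf H}$ on the left-hand side) for every $\mu\in\Delta(\mathcal{S})$.
   Context: $\mathcal{S}$ (states) and $\mathcal{A}$ (actions) are finite nonempty sets; $\Delta(E)$ denotes the set of probability distributions on a finite set $E$. Elements of an uncertainty set $\mathcal{P} \subset \Delta(\mathcal{S})^{\mathcal{S}\times\mathcal{A}}$ are written $P=(P_{sa})_{(s,a)}$ with $P_{sa}\in\Delta(\mathcal{S})\subset\mathbb{R}^{\mathcal{S}}$. $\Pi_{\mathsf H}$ is the set of history-dependent policies, i.e. maps from finite histories $(s_0,a_0,\dots,s_{t-1},a_{t-1},s_t)$, $t\ge 0$, to $\Delta(\mathcal{A})$; $\Pi_{\mathsf S}=\Delta(\mathcal{A})^{\mathcal{S}}\subset\Pi_{\mathsf H}$ is the set of stationary policies, $\pi=(\pi_{sa})$. Rewards are independent of the next state: $r=(r_{sa})\in\mathbb{R}^{\mathcal{S}\times\mathcal{A}}$.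 For $\gamma\in[0,1)$, $\pi\in\Pi_{\mathsf H}$, $P\in\mathcal{P}$: $v^{\pi,P}_s=\mathbb{E}^{\pi,P}\big[\sum_{t\ge 0}\gamma^t r_{s_ta_t}\,\big|\,s_0=s\big]$ (with $0^0=1$), where $a_t$ is drawn according to $\pi$ and $s_{t+1}\sim P_{s_ta_t}$. For $\pi\in\Pi_{\mathsf S}$, $u^{\pi}\in\mathbb{R}^{\mathcal{S}}$ is the unique vector satisfying $u^\pi_s=\min_{P\in\mathcal{P}}\sum_{a}\pi_{sa}(r_{sa}+\gamma P_{sa}^\top u^\pi)$ for all $s$. $\mathcal{P}$ is weakly s-tractable if for all $\pi\in\Pi_{\mathsf S}$, $r\in\mathbb{R}^{\mathcal{S}\times\mathcal{A}}$, $\gamma\in[0,1)$, $\mu\in\Delta(\mathcal{S})$: $\min_{P\in\mathcal{P}}\mu^\top v^{\pi,P}=\mu^\top u^\pi$. *)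

(* Defs.v *)
From HB Require Import structures.
From mathcomp Require Import all_boot all_order all_algebra.
From mathcomp Require Import all_classical all_reals all_analysis.

Set Implicit Arguments.
Unset Strict Implicit.
Unset Printing Implicit Defensive.

Import Order.TTheory GRing.Theory Num.Theory.
Import numFieldNormedType.Exports.
Local Open Scope classical_set_scope.
Local Open Scope ring_scope.

Section RobustMDP.
Context {R : realType} {S A : finType}.

Definition simplex (E : finType) : set (E -> R) :=
  [set p | (forall e, 0 <= p e) /\ \sum_e p e = 1].

(* [{ptws _ -> _}] is a plain function type carrying the topology of pointwise
   convergence: on finite index sets, the Euclidean topology on R^(S x A x S). *)
Definition transition : Type := {ptws S -> {ptws A -> {ptws S -> R}}}.
Definition transitions : set transition := [set P | forall s a, simplex (P s a)].

(* The history (s_0, a_0, ..., s_(t-1), a_(t-1), s_t) is represented by the list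
   [:: (s_0, a_0); ...; (s_(t-1), a_(t-1))] together with s_t. *)
Definition policy : Type := seq (S * A) -> S -> A -> R.
Definition history_policies : set policy :=
  [set pi | forall h s, simplex (pi h s)].
Definition stationary_policies : set (S -> A -> R) :=
  [set pi | forall s, simplex (pi s)].
Definition policy_of_stationary (pi : S -> A -> R) : policy := fun _ => pi.

Section Trajectories.
Context (pi : policy) (P : transition) (s : S).
Context {d : measure_display} {Omega : measurableType d}.
Context (Q : probability Omega R).
Context (X : nat -> Omega -> S) (Y : nat -> Omega -> A).

Definition past (t : nat) (w : Omega) : seq (S * A) :=
  mkseq (fun i => (X i w, Y i w)) t.

(* The processes X (states) and Y (actions) start at s and are driven by pi
   and P. The two conditional laws are written in product form, so that no
   division by the probability of a null history occurs. *)
Definition is_trajectory : Prop :=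
  [/\ forall t x, measurable [set w | X t w = x],
      forall t a, measurable [set w | Y t w = a],
      Q [set w | X 0%N w = s] = 1%E,
      forall t h x a,
        Q [set w | [/\ past t w = h, X t w = x & Y t w = a]] =
        (Q [set w | past t w = h /\ X t w = x] * (pi h x a)%:E)%E
    & forall t h x a x',
        Q [set w | [/\ past t w = h, X t w = x, Y t w = a & X t.+1 w = x']] =
        (Q [set w | [/\ past t w = h, X t w = x & Y t w = a]] *
          (P x a x')%:E)%E].

Definition discounted_return (r : S -> A -> R) (gamma : R) (w : Omega) : R :=
  limn (series (fun t => gamma ^+ t * r (X t w) (Y t w))).

End Trajectories.

(* The expectation depends only on the law of the trajectory, hence not on the
   probability space realizing it; [xget] selects this common value. *)
Definition value (r : S -> A -> R) (gamma : R) (pi : policy) (P : transition)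
    (s : S) : R :=
  xget 0 [set v | exists (d : measure_display) (Omega : measurableType d)
      (Q : probability Omega R) (X : nat -> Omega -> S) (Y : nat -> Omega -> A),
    is_trajectory pi P s Q X Y /\
    (v%:E = 'E_Q[discounted_return X Y r gamma])%E].

Definition dot (mu v : S -> R) : R := \sum_s mu s * v s.

Definition is_min (E : set R) (m : R) : Prop := E m /\ lbound E m.
Definition is_max (E : set R) (m : R) : Prop := E m /\ ubound E m.

(* [u] is u^pi: the unique solution of the fixed-point equations, selected by
   [xget]. *)
Definition robust_value (U : set transition) (r : S -> A -> R) (gamma : R)
    (pi : S -> A -> R) : S -> R :=
  xget (fun=> 0) [set u | forall s,
    is_min [set \sum_a pi s a * (r s a + gamma * dot (P s a) u) | P in U] (u s)].

Definition weakly_s_tractable (U : set transition) : Prop :=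
  forall (pi : S -> A -> R) (r : S -> A -> R) (gamma : R) (mu : S -> R),
    stationary_policies pi -> 0 <= gamma < 1 -> simplex mu ->
    is_min [set dot mu (value r gamma (policy_of_stationary pi) P) | P in U]
      (dot mu (robust_value U r gamma pi)).

Definition worst_case (U : set transition) (r : S -> A -> R) (gamma : R)
    (mu : S -> R) (pi : policy) : \bar R :=
  ereal_inf [set (dot mu (value r gamma pi P))%:E | P in U].

Definition optimal_value (U : set transition) (r : S -> A -> R) (gamma : R)
    (mu : S -> R) : \bar R :=
  ereal_sup [set worst_case U r gamma mu pi | pi in history_policies].

End RobustMDP.

Arguments transition : clear implicits.

(* Main.v *)
Require Import Defs.
From HB Require Import structures.
From mathcomp Require Import all_boot all_order all_algebra.
From mathcomp Require Import all_classical all_reals all_analysis.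
From mathcomp Require Import ring lra.
Import Order.TTheory GRing.Theory Num.Theory.
Import numFieldNormedType.Exports.
Local Open Scope classical_set_scope.
Local Open Scope ring_scope.
Set Implicit Arguments.
Unset Strict Implicit.
Unset Printing Implicit Defensive.

(** Write T for the operator whose value at a state s is the best guaranteed
one-step return, the maximum over p in the simplex of actions of the minimum
over P in U of [backup r gamma u s P p]. It is monotone and a constant shift of
its argument is damped by gamma, so it has a fixed point u
([discounted_fixpoint]). Both extrema are attained by compactness; choosing the
maximizers state by state gives a stationary policy pi whose robust value is u,
and weak s-tractability says that its worst case under mu is mu . u.

It remains to see that no history-dependent policy guarantees more than mu . u.
For this, one single P in U is produced such that one-step returns computed
with P and u never exceed u, whatever the action ([dominating_transition]).
Against this P every policy, with or without memory, has value at most u: along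
a trajectory, gamma^t u(X_t) plus the discounted reward collected before t is
then a supermartingale ([value_le]).

The existence of P is a minimax statement in which weak s-tractability replaces
rectangularity. The inner minima in T are taken separately at each state, and a
priori by different elements of U. However, weak s-tractability holds for all
rewards: for a given stationary policy and the vector u, shift the reward at
each state so that u becomes the robust value of the policy. With mu uniform,
the minimizer P of mu . v satisfies v = u in every coordinate, hence attains
the inner minimum at all states at once ([simultaneous_minimizer]). So for each
stationary policy some P in U keeps all backups of u below u. A nonnegative
weighting of state-action pairs is a stationary policy with weighted states,
and the theorem of the alternative for the convex compact set U
([convex_alternative]) exchanges the two quantifiers.

Values are defined through trajectories on arbitrary probability spaces. That
such trajectories exist is proved by reading them off a uniform point of
[0, 1], by splitting intervals proportionally to the conditional laws
([word_process_exists], [trajectory_exists]); that their expected return is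
governed by the backups is a telescoping argument and dominated convergence
([expected_return_cvg]). *)

(** * Discounted monotone operators *)

Section Discounted.
Context {R : realType} {S : finType}.
Implicit Types (F : (S -> R) -> S -> R) (u v w : S -> R).

Definition discounted (gamma : R) F :=
  (forall u v, (forall s, u s <= v s) -> forall s, F u s <= F v s) /\
  (forall u c s, 0 <= c -> F (fun x => u x + c) s <= F u s + gamma * c).

Lemma finite_max (f : S -> R) : (0 < #|S|)%N ->
  exists s0, forall s, f s <= f s0.
Proof.
move=> /card_gt0P[s1 _].
have [i _ hi] := @arg_maxP _ _ _ s1 predT f isT.
by exists i => s; exact: hi.
Qed.

(** A maximum principle: if c is the largest excess of u over w and c > 0, then
at a state where it is reached, u <= F u <= F (w + c) <= w + gamma c < u. *)
Lemma discounted_comparison gamma F u w : gamma < 1 -> discounted gamma F ->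
  (forall s, u s <= F u s) -> (forall s, F w s <= w s) ->
  forall s, u s <= w s.
Proof.
move=> g1 [monoF discF] uF Fw s.
have S0 : (0 < #|S|)%N by apply/card_gt0P; exists s.
have [s0 hs0] := finite_max (fun x => u x - w x) S0.
have [le0|gt0] := leP (u s0 - w s0) 0.
  by rewrite -subr_le0; exact: le_trans (hs0 s) le0.
set c := u s0 - w s0 in hs0 gt0 *.
have le1 : F u s0 <= F (fun x => w x + c) s0.
  by apply: monoF => x; have := hs0 x; lra.
have := discF w c s0 (ltW gt0); have := uF s0; have := Fw s0.
have : 0 < (1 - gamma) * c by rewrite mulr_gt0// subr_gt0.
rewrite mulrBl mul1r => h1 h2 h3 h4; exfalso.
by move: h1 h2 h3 h4 le1; rewrite /c; lra.
Qed.

(** The fixed point is the pointwise supremum of the subsolutions, as in the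
Knaster-Tarski theorem: monotonicity makes this supremum w a subsolution, hence
also F w, so that F w <= w. The damping only serves to find constant sub- and
supersolutions, which make the supremum finite. *)
Lemma discounted_fixpoint gamma F : 0 <= gamma < 1 -> discounted gamma F ->
  exists u, forall s, F u s = u s.
Proof.
move=> /andP[g0 g1] dF; have [monoF discF] := dF.
case: (posnP #|S|) => [S0|S0].
  by exists (fun=> 0) => s; have := card0_eq S0 s; rewrite inE.
have [s0 hs0] := finite_max (fun s => `|F (fun=> 0) s|) S0.
pose K := `|F (fun=> 0) s0| / (1 - gamma).
have gK : (1 - gamma) * K = `|F (fun=> 0) s0|.
  by rewrite mulrC divfK// gt_eqF// subr_gt0.
have K0 : 0 <= K by rewrite divr_ge0// subr_ge0 ltW.
have sup_sol s : F (fun=> K) s <= K.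
  have := discF (fun=> 0) K s K0; rewrite (_ : (fun=> 0 + K) = fun=> K).
    have := hs0 s; have := ler_norm (F (fun=> 0) s).
    by rewrite -gK mulrBl; lra.
  by apply/funext => x; rewrite add0r.
have sub_sol s : - K <= F (fun=> - K) s.
  have := discF (fun=> - K) K s K0; rewrite (_ : (fun=> - K + K) = fun=> 0).
    have := hs0 s; have := ler_norm (- F (fun=> 0) s); rewrite normrN.
    by rewrite -gK mulrBl; lra.
  by apply/funext => x; rewrite addNr.
pose E : set (S -> R) := [set u | forall s, u s <= F u s].
have EK u : E u -> forall s, u s <= K.
  by move=> Eu; apply: (discounted_comparison g1 dF Eu sup_sol).
pose w s := sup [set u s | u in E].
have hs s : has_sup [set u s | u in E].
  split; first by exists (- K), (fun=> - K).
  by exists K => _ [u Eu <-]; exact: EK.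
have wub u : E u -> forall s, u s <= w s.
  by move=> Eu s; apply: (sup_upper_bound (hs s)); exists u.
have wF s : w s <= F w s.
  apply: ge_sup; first by case: (hs s).
  by move=> _ [u Eu <-]; apply: le_trans (Eu s) _; apply: monoF; exact: wub.
exists w => s; apply/le_anti; rewrite wF andbT; apply: (wub (F w)).
by move=> x; apply: monoF.
Qed.

End Discounted.

(** * Continuity and compactness *)

Lemma continuous_sum {R : realType} {T : topologicalType} {I : finType}
    (f : I -> T -> R) :
  (forall i, continuous (f i)) -> continuous (fun x => \sum_i f i x).
Proof.
move=> cf; apply: (@continuous_big _ _ _ _ _ (@add_continuous R)) => i _.
exact: cf.
Qed.

Lemma continuous_scale {R : realType} {T : topologicalType} (c : R)
    (f : T -> R) : continuous f -> continuous (fun x => c * f x).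
Proof. by move=> cf x; apply: cvgMl_tmp; exact: cf. Qed.

Lemma continuous_shift {R : realType} {T : topologicalType} (c : R)
    (f : T -> R) : continuous f -> continuous (fun x => c + f x).
Proof. by move=> cf x; apply: cvgD; [exact: cvg_cst|exact: cf]. Qed.

Lemma continuous_dist {R : realType} {T : topologicalType} (c : R)
    (f : T -> R) : continuous f -> continuous (fun x => `|c - f x|).
Proof.
by move=> cf x; apply: cvg_norm; apply: cvgB; [exact: cvg_cst|exact: cf].
Qed.

(** Continuity from a bound d on the oscillation of h, where d need not be a
metric: it applies to Lipschitz bounds written in coordinates of a product
space. *)
Lemma continuous_modulus {R : realType} {T : topologicalType} (h : T -> R)
    (d : T -> T -> R) :
  (forall p, continuous (d p)) -> (forall p, d p p = 0) ->
  (forall p q, `|h p - h q| <= d p q) -> continuous h.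
Proof.
move=> cd dd hd p.
apply: (@squeeze_cvgr _ _ _ _ (fun q => h p - d p q) (fun q => h p + d p q)).
- by apply: nearW => q; rewrite -ler_distlC.
- rewrite -[X in _ --> X]subr0 -(dd p); apply: cvgB; first exact: cvg_cst.
  exact: cd.
- rewrite -[X in _ --> X]addr0 -(dd p); apply: cvgD; first exact: cvg_cst.
  exact: cd.
Qed.

Lemma simplex_nonempty (R : realType) (E : finType) : (0 < #|E|)%N ->
  @simplex R E !=set0.
Proof.
move=> /card_gt0P[a _].
exists (fun b => (b == a)%:R); split => [b|]; first by rewrite ler0n.
by rewrite (bigD1 a)//= eqxx big1 ?addr0// => b /negbTE ->.
Qed.

(** A closed subset of the cube [0, 1]^E, which is compact by Tychonoff. *)
Lemma compact_simplex (R : realType) (E : finType) :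
  compact (@simplex R E : set {ptws E -> R}).
Proof.
have K := @tychonoff E (fun=> R : topologicalType) (fun=> `[0, 1]%classic)
  (fun=> @segment_compact R 0 1).
apply: (subclosed_compact _ K); last first.
  move=> p [p0 p1] e /=; rewrite in_itv/= p0/= -p1 (bigD1 e)//= lerDl.
  by rewrite sumr_ge0.
have cp (e : E) : continuous (fun p : {ptws E -> R} => p e).
  exact: (@proj_continuous E (fun=> R : topologicalType) e).
rewrite [X in closed X](_ : _ = (\bigcap_(e in [set: E])
    ((fun p : {ptws E -> R} => p e) @^-1` [set x | 0 <= x])) `&`
    ((fun p : {ptws E -> R} => \sum_e p e) @^-1` [set 1])); last first.
  apply/seteqP; split => [p [p0 p1]|p [p0 p1]]; split => //.
    by move=> e _; exact: p0.
  by move=> e; exact: (p0 e I).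
apply: closedI.
  by apply: closed_bigI => e _; apply: preimage_closed; [move=> ? _; exact: cp
    |exact: closed_ge].
apply: preimage_closed; last exact: closed_eq.
by move=> p _; exact: continuous_sum.
Qed.

Lemma continuous_transition {R : realType} {S A : finType} (s : S) (a : A)
    (x : S) : continuous (fun P : transition R S A => P s a x).
Proof.
move=> P; apply: (@continuous_comp _ _ _
  (fun P : transition R S A => P s a) (fun p : {ptws S -> R} => p x)).
  apply: (@continuous_comp _ _ _
    (fun P : transition R S A => P s)
    (fun p : {ptws A -> {ptws S -> R}} => p a)).
  exact: (@proj_continuous S (fun=> {ptws A -> {ptws S -> R}}) s).
  exact: (@proj_continuous A (fun=> {ptws S -> R}) a).
exact: (@proj_continuous S (fun=> R : topologicalType) x).
Qed.

Lemma is_min_inf {R : realType} (E : set R) m : is_min E m -> inf E = m.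
Proof.
move=> [Em lbm]; apply/le_anti/andP; split.
  by apply: ge_inf => //; exists m.
by apply: lb_le_inf => //; exists m.
Qed.

(** * Bellman backups *)

Section Backup.
Context {R : realType} {S A : finType}.
Implicit Types (r : S -> A -> R) (u : S -> R) (P : transition R S A)
  (p : A -> R) (U : set (transition R S A)).

Definition backup r gamma u s P p : R :=
  \sum_a p a * (r s a + gamma * dot (P s a) u).

(** The adversary may answer each state with its own P: in [robust_backup], the
minimum is taken separately at each s. *)
Definition robust_backup U r gamma u s p : R :=
  inf [set backup r gamma u s P p | P in U].

Definition optimal_backup U r gamma u s : R :=
  sup [set robust_backup U r gamma u s p | p in simplex (E := A)].

Lemma continuous_backup r gamma u s p :
  continuous (fun P => backup r gamma u s P p).
Proof.
apply: continuous_sum => a; apply: continuous_scale.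
apply: continuous_shift; apply: continuous_scale.
apply: continuous_sum => x.
have -> : (fun P => P s a x * u x) = (fun P => u x * P s a x).
  by apply/funext => P; rewrite mulrC.
by apply: continuous_scale; exact: continuous_transition.
Qed.

Lemma robust_backup_min U r gamma u s p : compact U -> U !=set0 ->
  is_min [set backup r gamma u s P p | P in U] (robust_backup U r gamma u s p).
Proof.
move=> cU U0.
have [P /set_mem UP minP] := compact_EVT_min U0 cU
  (continuous_subspaceT (@continuous_backup r gamma u s p)).
have mP : is_min [set backup r gamma u s P' p | P' in U]
    (backup r gamma u s P p).
  by split; [exists P|move=> _ [P' UP' <-]; apply: minP; exact: mem_set].
by rewrite /robust_backup (is_min_inf mP).
Qed.

Lemma robust_backup_le U r gamma u s p P : compact U -> U P ->
  robust_backup U r gamma u s p <= backup r gamma u s P p.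
Proof.
move=> cU UP; have U0 : U !=set0 by exists P.
by have [_] := robust_backup_min r gamma u s p cU U0; apply; exists P.
Qed.

Lemma robust_backup_attained U r gamma u s p : compact U -> U !=set0 ->
  exists2 P, U P & robust_backup U r gamma u s p = backup r gamma u s P p.
Proof.
move=> cU U0; have [[P UP <-] _] := robust_backup_min r gamma u s p cU U0.
by exists P.
Qed.

Lemma le_backup r gamma u v s P p : 0 <= gamma -> transitions P -> simplex p ->
  (forall x, u x <= v x) -> backup r gamma u s P p <= backup r gamma v s P p.
Proof.
move=> g0 tP [p0 _] uv; apply: ler_sum => a _; apply: ler_wpM2l => //.
rewrite lerD2l ler_wpM2l// ler_sum// => x _; apply: ler_wpM2l => //.
by case: (tP s a).
Qed.

Lemma backupDc r gamma u c s P p : transitions P -> simplex p ->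
  backup r gamma (fun x => u x + c) s P p = backup r gamma u s P p + gamma * c.
Proof.
move=> tP [_ p1]; rewrite -[gamma * c]mul1r -p1 mulr_suml -big_split/=.
apply: eq_bigr => a _; rewrite -mulrDr -addrA -mulrDr; congr (_ * (_ + _ * _)).
rewrite /dot -[X in _ + X]mul1r; have [_ <-] := tP s a.
by rewrite mulr_suml -big_split/=; apply: eq_bigr => x _; rewrite mulrDr.
Qed.

Lemma discounted_backup r gamma (pi : S -> A -> R) P : 0 <= gamma ->
  transitions P -> stationary_policies pi ->
  discounted gamma (fun u s => backup r gamma u s P (pi s)).
Proof.
move=> g0 tP spi; split => [u v uv s|u c s c0].
  by apply: le_backup => //; exact: spi.
by rewrite backupDc//; exact: spi.
Qed.

Section CompactUncertainty.
Variables (U : set (transition R S A)) (r : S -> A -> R) (gamma : R).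
Hypotheses (tU : U `<=` transitions) (U0 : U !=set0) (cU : compact U).
Hypothesis g0 : 0 <= gamma.

Lemma le_robust_backup u v s p : simplex p -> (forall x, u x <= v x) ->
  robust_backup U r gamma u s p <= robust_backup U r gamma v s p.
Proof.
move=> sp uv; have [P UP ->] := robust_backup_attained r gamma v s p cU U0.
apply: le_trans (robust_backup_le _ _ _ _ _ cU UP) _.
by apply: le_backup => //; exact: tU.
Qed.

Lemma robust_backupDc u c s p : simplex p ->
  robust_backup U r gamma (fun x => u x + c) s p <=
  robust_backup U r gamma u s p + gamma * c.
Proof.
move=> sp; have [P UP ->] := robust_backup_attained r gamma u s p cU U0.
apply: le_trans (robust_backup_le _ _ _ _ _ cU UP) _.
by rewrite backupDc//; exact: tU.
Qed.

Lemma discounted_robust_backup (pi : S -> A -> R) : stationary_policies pi ->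
  discounted gamma (fun u s => robust_backup U r gamma u s (pi s)).
Proof.
move=> spi; split => [u v uv s|u c s _].
  by apply: le_robust_backup => //; exact: spi.
by apply: robust_backupDc; exact: spi.
Qed.

(** An infimum of functions with a common Lipschitz constant inherits it, which
gives the continuity in p needed to attain the maximum in [optimal_backup]. *)
Lemma robust_backup_lipschitz u s : exists K, forall p q,
  robust_backup U r gamma u s p <=
  robust_backup U r gamma u s q + K * \sum_a `|p a - q a|.
Proof.
pose K := \sum_a (`|r s a| + gamma * \sum_x `|u x|).
exists K => p q.
have [P UP ->] := robust_backup_attained r gamma u s q cU U0.
apply: le_trans (robust_backup_le _ _ _ _ _ cU UP) _.
rewrite -lerBlDl -sumrB mulr_sumr; apply: ler_sum => a _.
rewrite -mulrBl; apply: le_trans (ler_norm _) _; rewrite normrM mulrC.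
apply: ler_wpM2r => //; rewrite /K (bigD1 a)//=; apply: ler_wpDr.
  apply: sumr_ge0 => b _; apply: addr_ge0 => //; apply: mulr_ge0 => //.
  by apply: sumr_ge0.
apply: le_trans (ler_normD _ _) _; rewrite lerD2l normrM ger0_norm//.
apply: ler_wpM2l => //; apply: le_trans (ler_norm_sum _ _ _) _.
apply: ler_sum => x _; rewrite normrM -[leRHS]mul1r ler_wpM2r//.
have [Psa0 <-] := tU UP s a.
by rewrite ger0_norm// (bigD1 x)//= lerDl sumr_ge0.
Qed.

Lemma continuous_robust_backup u s :
  continuous (fun p : {ptws A -> R} => robust_backup U r gamma u s p).
Proof.
have [K hK] := robust_backup_lipschitz u s.
apply: (@continuous_modulus R {ptws A -> R} _
  (fun p q => K * \sum_a `|p a - q a|)).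
- move=> p; apply: continuous_scale; apply: continuous_sum => a.
  apply: continuous_dist.
  exact: (@proj_continuous A (fun=> R : topologicalType) a).
- by move=> p; rewrite big1 ?mulr0// => a _; rewrite subrr normr0.
- move=> p q; have := hK p q; have := hK q p.
  under eq_bigr do rewrite distrC.
  by move=> h1 h2; rewrite ler_norml; apply/andP; split; lra.
Qed.

Hypothesis A0 : (0 < #|A|)%N.

Lemma optimal_backup_max u s :
  (exists2 p, simplex p &
     robust_backup U r gamma u s p = optimal_backup U r gamma u s) /\
  (forall p, simplex p ->
     robust_backup U r gamma u s p <= optimal_backup U r gamma u s).
Proof.
have [p /set_mem sp maxp] := @compact_EVT_max {ptws A -> R} R _ _
  (simplex_nonempty R A0) (@compact_simplex R A)
  (continuous_subspaceT (@continuous_robust_backup u s)).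
have ub : ubound [set robust_backup U r gamma u s q | q in simplex (E := A)]
    (robust_backup U r gamma u s p).
  by move=> _ [q sq <-]; apply: maxp; exact: mem_set.
have E : optimal_backup U r gamma u s = robust_backup U r gamma u s p.
  apply/le_anti/andP; split.
    by apply: ge_sup => //; exists (robust_backup U r gamma u s p), p.
  by apply: ub_le_sup; [eexists; exact: ub|exists p].
by rewrite E; split=> [|q sq]; [exists p|apply: ub; exists q].
Qed.

Lemma discounted_optimal_backup :
  discounted gamma (optimal_backup U r gamma).
Proof.
split => [u v uv s|u c s _].
  have [[p sp <-] _] := optimal_backup_max u s.
  have [_ /(_ p sp)] := optimal_backup_max v s; apply: le_trans.
  exact: le_robust_backup.
have [[p sp <-] _] := optimal_backup_max (fun x => u x + c) s.
apply: le_trans (robust_backupDc _ _ _ sp) _; rewrite lerD2r.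
by have [_] := optimal_backup_max u s; apply.
Qed.

End CompactUncertainty.
End Backup.

(** * A theorem of the alternative on compact convex sets *)

(** Project onto the nonpositive orthant: let x minimize the sum of the squares
of the positive parts l_i of the g_i x. If y satisfies sum_i l_i g_i y <= 0 for
the weights l_i, moving from x towards y changes this sum at first order by
2 t sum_i l_i (g_i y - g_i x) <= - 2 t sum_i l_i^2, so minimality forces all
l_i to vanish. Only the values of the g_i along segments matter, whence the
form of the convexity assumption. *)
Lemma convex_alternative {R : realType} {T : topologicalType} {I : finType}
    (U : set T) (g : I -> T -> R) :
  compact U -> U !=set0 -> (forall i, continuous (g i)) ->
  (forall x y t, U x -> U y -> 0 <= t <= 1 ->
    exists2 z, U z & forall i, g i z = t * g i x + (1 - t) * g i y) ->
  (forall l : I -> R, (forall i, 0 <= l i) ->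
    exists2 x, U x & \sum_i l i * g i x <= 0) ->
  exists2 x, U x & forall i, g i x <= 0.
Proof.
move=> cU U0 cg convU alt.
pose pos x : R := Num.max 0 x.
have pos0 x : 0 <= pos x by rewrite le_max lexx.
have lepos x : x <= pos x by rewrite le_max lexx orbT.
have cpos : continuous pos.
  apply: (@continuous_modulus R R pos (fun x y => `|x - y|)) => [x|x|x y].
  - by apply: continuous_dist => y; exact: cvg_id.
  - by rewrite subrr normr0.
  - rewrite ler_norml /pos /Num.max.
    have := ler_norm (x - y); have := ler_norm (y - x); rewrite distrC.
    by case: ltP => x0; case: ltP => y0; move=> h1 h2;
      apply/andP; split; have := normr_ge0 (x - y); lra.
pose Phi x := \sum_i pos (g i x) ^+ 2.
have cPhi : continuous Phi.
  apply: continuous_sum => i x.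
  apply: (@continuous_comp _ _ _ (g i) (fun y => pos y ^+ 2)); first exact: cg.
  apply: (@continuous_comp _ _ _ pos (fun y => y ^+ 2)); first exact: cpos.
  exact: exprn_continuous.
have [x /set_mem Ux minx] :=
  compact_EVT_min U0 cU (continuous_subspaceT cPhi).
exists x => //.
have [y Uy ly] := alt (fun i => pos (g i x)) (fun i => pos0 _).
pose L := Phi x; pose B := \sum_i (g i y - g i x) ^+ 2.
have L0 : 0 <= L by apply: sumr_ge0 => i _; exact: sqr_ge0.
have B0 : 0 <= B by apply: sumr_ge0 => i _; exact: sqr_ge0.
have descent : \sum_i pos (g i x) * (g i y - g i x) <= - L.
  rewrite (eq_bigr _ (fun i _ => mulrBr _ _ _)) sumrB.
  suff -> : \sum_i pos (g i x) * g i x = L by lra.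
  apply: eq_bigr => i _; rewrite /pos /Num.max; case: ltP => // _.
  by rewrite mul0r expr0n.
(* Expansion along the segment from x to y, using pos (a + b) <= |pos a + b|. *)
have step t : 0 <= t <= 1 -> L <= L - 2 * t * L + t ^+ 2 * B.
  move=> /[dup] t01 /andP[t0 t1].
  have [z Uz gz] := convU y x t Uy Ux t01.
  have le1 : L <= Phi z by apply: minx; exact: mem_set.
  apply: le_trans le1 _.
  have : Phi z <= \sum_i (pos (g i x) + t * (g i y - g i x)) ^+ 2.
    apply: ler_sum => i _; rewrite gz {1}/pos /Num.max; case: ltP => // h.
      by rewrite ler_sqr ?nnegrE; have := lepos (g i x); lra.
    by rewrite expr0n sqr_ge0.
  move=> /le_trans; apply.
  under eq_bigr do rewrite sqrrD exprMn.
  rewrite !big_split/= -/L -mulr_sumr -/B lerD2r lerD2l.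
  under eq_bigr do rewrite mulrCA.
  by rewrite -mulr_sumr; nra.
have : L = 0.
  apply/eqP; rewrite eq_le L0 andbT leNgt; apply/negP => Lgt0.
  (* At t = L / (L + B) the quadratic term t^2 B is at most t L. *)
  have LB : 0 < L + B by lra.
  have t01 : 0 <= L / (L + B) <= 1.
    apply/andP; split; first by apply: divr_ge0 => //; exact: ltW.
    by rewrite ler_pdivrMr// mul1r; lra.
  have tLB : L / (L + B) * (L + B) = L by rewrite divfK// gt_eqF.
  have tgt0 : 0 < L / (L + B) by rewrite divr_gt0.
  have := step _ t01; move: (L / (L + B)) t01 tLB tgt0 => t t01 tLB t0 h.
  have : 0 < t * L by rewrite mulr_gt0.
  have : t ^+ 2 * B = t * (L - t * L) by rewrite -[X in X - _]tLB; ring.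
  by move=> e1 e2; move: h; rewrite e1; nra.
move=> /eqP; rewrite psumr_eq0; last by move=> i _; exact: sqr_ge0.
move=> /allP h i; have := h i (mem_index_enum i); rewrite sqrf_eq0.
by move=> /eqP e; apply: le_trans (lepos _) _; rewrite e.
Qed.

(** * Random variables with finitely many values *)

Lemma sum_prod {V : nmodType} {I J : finType} (G : I * J -> V) :
  \sum_p G p = \sum_i \sum_j G (i, j).
Proof. by rewrite pair_bigA; apply: eq_bigr => -[]. Qed.

Section FiniteValued.
Context {d : measure_display} {Omega : measurableType d} {R : realType}.
Variable Q : probability Omega R.

Lemma measure_fibers (F : finType) (Z : Omega -> F) (B : set Omega) :
  measurable B -> (forall f, measurable [set w | Z w = f]) ->
  Q B = (\sum_f Q (B `&` [set w | Z w = f]))%E.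
Proof.
move=> mB mZ.
have BE : B = \bigcup_(f in [set` index_enum F]) (B `&` [set w | Z w = f]).
  apply/seteqP; split => [w Bw|w [f _ []//]].
  by exists (Z w) => //=; exact: mem_index_enum.
rewrite {1}BE measure_fin_bigcup//=.
- by rewrite -fsbig_seq ?index_enum_uniq.
- by move=> f f' _ _ [w [[_ <-] [_ <-]]].
- by move=> f _; exact: measurableI.
Qed.

Lemma integral_finite_valued (F : finType) (Z : Omega -> F) (g : F -> R) :
  (forall f, measurable [set w | Z w = f]) ->
  Q.-integrable setT (fun w => (g (Z w))%:E) /\
  (\int[Q]_w (g (Z w))%:E = (\sum_f g f * fine (Q [set w | Z w = f]))%:E)%E.
Proof.
move=> mZ.
have gZ w : ((g (Z w))%:E =
    \sum_(f <- index_enum F) (g f)%:E * (\1_[set w | Z w = f] w)%:E)%E.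
  rewrite (bigD1_seq (Z w)) ?mem_index_enum ?index_enum_uniq//= big1.
    by rewrite indicE mem_set// mule1 adde0.
  by move=> f fZ; rewrite indicE memNset ?mule0//= => Zf; rewrite Zf eqxx in fZ.
have int1 f : Q.-integrable setT
    (fun w => ((g f)%:E * (\1_[set w | Z w = f] w)%:E)%E).
  by apply: integrableZl => //; exact: integrable_indic.
have -> : (fun w => (g (Z w))%:E) = (fun w =>
    \sum_(f <- index_enum F) (g f)%:E * (\1_[set w | Z w = f] w)%:E)%E.
  exact/funext.
split; first by apply: integrable_sum => // f _; exact: int1.

rewrite integral_sum// -sumEFin; apply: eq_bigr => f _.
rewrite integralZl//; last exact: integrable_indic.
by rewrite integral_indic// setIT EFinM fineK// fin_num_measure.
Qed.

End FiniteValued.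

(** * Expected discounted return along a trajectory *)

Section Past.
Context {S A : finType} {d : measure_display} {Omega : measurableType d}.
Variables (X : nat -> Omega -> S) (Y : nat -> Omega -> A).

Lemma pastS t w : past X Y t.+1 w = rcons (past X Y t w) (X t w, Y t w).
Proof. by rewrite /past mkseqS. Qed.

Hypotheses (mX : forall t x, measurable [set w | X t w = x])
  (mY : forall t a, measurable [set w | Y t w = a]).

Lemma measurable_past t h : measurable [set w | past X Y t w = h].
Proof.
elim: t h => [|t IHt] h.
  have [<-|h0] := eqVneq [::] h.
    by rewrite (_ : [set w | _] = setT)//; apply/seteqP.
  rewrite (_ : [set w | _] = set0)//; apply/seteqP; split => // w /= hw.
  by move: h0; rewrite -hw eqxx.
under eq_set do rewrite pastS.
case/lastP: h => [|h e].
  rewrite (_ : [set w | _] = set0)//; apply/seteqP; split => // w /=.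
  by move=> /(congr1 size); rewrite size_rcons.
rewrite (_ : [set w | _] = [set w | past X Y t w = h] `&`
    ([set w | X t w = e.1] `&` [set w | Y t w = e.2])).
  by apply: measurableI => //; apply: measurableI.
apply/seteqP; split => w /=.
  by move=> /rcons_inj[-> <-].
by move=> [-> [-> ->]]; case: e.
Qed.

Lemma measurable_past_state t h x :
  measurable [set w | past X Y t w = h /\ X t w = x].
Proof. exact: measurableI (measurable_past t h) (mX t x). Qed.

End Past.

Section Return.
Context {R : realType} {S A : finType}.
Variables (pi : @policy R S A) (P : transition R S A) (s : S).
Context {d : measure_display} {Omega : measurableType d}.
Variables (Q : probability Omega R) (X : nat -> Omega -> S)
  (Y : nat -> Omega -> A).
Hypothesis traj : is_trajectory pi P s Q X Y.
Hypotheses (spi : history_policies pi) (tP : transitions P).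
Variables (r : S -> A -> R) (gamma : R) (u : S -> R).
Hypotheses (g0 : 0 <= gamma) (g1 : gamma < 1).

(** The amount by which one step of pi and P from x, after the history h, is
expected to increase the potential u. *)
Definition residual h x : R :=
  \sum_a pi h x a * (r x a + gamma * dot (P x a) u) - u x.

(** The increment realized at time t, known as the temporal difference. *)
Definition td t w : R := r (X t w) (Y t w) + gamma * u (X t.+1 w) - u (X t w).

Definition occupation t h x : R :=
  fine (Q [set w | past X Y t w = h /\ X t w = x]).

Lemma occupation_ge0 t h x : 0 <= occupation t h x.
Proof. exact: fine_ge0. Qed.

(** The conditional laws of [is_trajectory], averaged over all histories of
length t, turn the increment into the average of [residual]. *)
Lemma integral_td t :
  Q.-integrable setT (fun w => (td t w)%:E) /\
  (\int[Q]_w (td t w)%:E =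
    (\sum_(h : t.-tuple (S * A)) \sum_x occupation t h x * residual h x)%:E)%E.
Proof.
have [mX mY _ lawY lawX] := traj.
pose F : finType := (t.-tuple (S * A) * S * A * S)%type.
pose Z w : F := (@Tuple _ _ (past X Y t w)
  (introT eqP (size_mkseq (fun i => (X i w, Y i w)) t)),
  X t w, Y t w, X t.+1 w).
pose g (f : F) : R :=
  let: (h, x, a, x') := f in r x a + gamma * u x' - u x.
have ZE (h : t.-tuple (S * A)) x a x' : [set w | Z w = (h, x, a, x')] =
    [set w | [/\ past X Y t w = h, X t w = x, Y t w = a & X t.+1 w = x']].
  apply/seteqP; split => w /=; first by case=> <- <- <- <-.
  move=> [hw <- <- <-]; congr (_, _, _, _); exact: val_inj.
have mZ f : measurable [set w | Z w = f].
  case: f => [[[h x] a] x']; rewrite ZE.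
  rewrite (_ : [set w | _] = [set w | past X Y t w = h] `&`
    ([set w | X t w = x] `&` ([set w | Y t w = a] `&`
     [set w | X t.+1 w = x']))).
    by apply: measurableI; [exact: measurable_past|];
       do 2?[apply: measurableI => //].
  by apply/seteqP; split => w /= => [[]|[? []? []]].
have [intg ->] := integral_finite_valued Q g mZ; split=> //.
have law h x a x' : fine (Q [set w | Z w = (h, x, a, x')]) =
    occupation t h x * pi h x a * P x a x'.
  rewrite ZE lawX lawY.
  have mhx := measurable_past_state mX mY t h x.
  by rewrite -[X in (X * _ * _)%E](@fineK _ (Q _)) ?fin_num_measure// -!EFinM.
congr (_%:E); rewrite !sum_prod.
apply: eq_bigr => h _; apply: eq_bigr => x _.
have [_ pi1] := spi h x.
rewrite /residual -[u x]mul1r -pi1 mulr_suml -sumrB mulr_sumr.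
apply: eq_bigr => a _; rewrite -mulrBr.
have [_ P1] := tP x a.
have -> : r x a + gamma * dot (P x a) u - u x =
    \sum_x' P x a x' * (r x a + gamma * u x' - u x).
  under eq_bigr do rewrite mulrBr mulrDr (mulrCA _ gamma).
  by rewrite sumrB big_split/= -!mulr_suml P1 !mul1r -mulr_sumr.
rewrite 2!mulr_sumr; apply: eq_bigr => x' _; rewrite law/=; ring.
Qed.

Let Kr := \sum_x \sum_a `|r x a|.
Let Ku := \sum_x `|u x|.

Lemma reward_bound x a : `|r x a| <= Kr.
Proof.
rewrite /Kr (bigD1 x)//= (bigD1 a)//= -addrA lerDl.
by apply: addr_ge0; do ?apply: sumr_ge0 => *; rewrite ?sumr_ge0.
Qed.

Lemma potential_bound x : `|u x| <= Ku.
Proof. by rewrite /Ku (bigD1 x)//= lerDl sumr_ge0. Qed.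

Definition td_sum n w : R := \sum_(t < n) gamma ^+ t * td t w.

(** Summed with the discount, the potentials at intermediate times cancel. *)
Lemma td_sum_telescope n w : td_sum n w =
  series (fun t => gamma ^+ t * r (X t w) (Y t w)) n +
  gamma ^+ n * u (X n w) - u (X 0 w).
Proof.
rewrite /td_sum /series/=.
elim: n => [|n IHn]; first by rewrite big_ord0 big_geq// expr0; ring.
by rewrite big_ord_recr/= IHn big_nat_recr//= /td exprS; ring.
Qed.

Lemma cvg_geometric_gamma (c : R) : gamma ^+ n * c @[n --> \oo] --> (0 : R).
Proof.
rewrite -[X in _ --> X](mul0r c); apply: cvgMr_tmp.
by apply: cvg_expr; rewrite ger0_norm.
Qed.

Lemma is_cvg_return w :
  cvgn (series (fun t => gamma ^+ t * r (X t w) (Y t w))).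
Proof.
apply: normed_cvg; apply: (@series_le_cvg _ _ (geometric Kr gamma)) => [n|n|n|].
- exact: normr_ge0.
- rewrite /= mulr_ge0 ?exprn_ge0//.
  exact: le_trans (reward_bound (X n w) (Y n w)).
- rewrite /= normrM normrX (ger0_norm g0) mulrC ler_wpM2r ?exprn_ge0//.
  exact: reward_bound.
- by apply: is_cvg_geometric_series; rewrite ger0_norm.
Qed.

Lemma td_bound t w : `|td t w| <= Kr + gamma * Ku + Ku.
Proof.
rewrite /td; apply: le_trans (ler_normB _ _) _.
apply: lerD; last exact: potential_bound.
apply: le_trans (ler_normD _ _) _.
apply: lerD; first exact: reward_bound.
by rewrite normrM ger0_norm// ler_wpM2l// potential_bound.
Qed.

Lemma td_sum_bound n w : `|td_sum n w| <= (Kr + gamma * Ku + Ku) / (1 - gamma).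
Proof.
set K := Kr + _ + _; have K0 : 0 <= K := le_trans (normr_ge0 _) (td_bound 0 w).
have g10 : 0 < 1 - gamma by rewrite subr_gt0.
apply: (@le_trans _ _ (\sum_(t < n) gamma ^+ t * K)).
  apply: le_trans (ler_norm_sum _ _ _) _; apply: ler_sum => t _.
  by rewrite normrM normrX (ger0_norm g0) ler_wpM2l ?exprn_ge0// td_bound.
rewrite -mulr_suml mulrC ler_wpM2l// -[leRHS]mul1r ler_pdivlMr// mulrC.
have := subrX1 gamma n; have := exprn_ge0 n g0.
by rewrite -[X in _ = X]opprK -mulNr opprB => h1 h2; lra.
Qed.

Lemma td_sum_cvg w : td_sum ^~ w @ \oo -->
  discounted_return X Y r gamma w - u (X 0 w).
Proof.
rewrite (_ : td_sum ^~ w = fun n =>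
    series (fun t => gamma ^+ t * r (X t w) (Y t w)) n +
    gamma ^+ n * u (X n w) - u (X 0 w)); last first.
  by apply/funext => n; rewrite td_sum_telescope.
apply: cvgB; last exact: cvg_cst.
rewrite -[X in _ --> X]addr0; apply: cvgD; first exact: is_cvg_return.
apply: (@squeeze_cvgr _ _ _ _ (fun n => - (gamma ^+ n * Ku))
  (fun n => gamma ^+ n * Ku)).
- apply: nearW => n; rewrite -ler_norml normrM normrX (ger0_norm g0).
  by rewrite ler_wpM2l ?exprn_ge0// potential_bound.
- by rewrite -oppr0; apply: cvgN; exact: cvg_geometric_gamma.
- exact: cvg_geometric_gamma.
Qed.

Lemma integral_td_sum n :
  Q.-integrable setT (fun w => (td_sum n w)%:E) /\
  (\int[Q]_w (td_sum n w)%:E = (\sum_(t < n) gamma ^+ t *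
    \sum_(h : t.-tuple (S * A)) \sum_x occupation t h x * residual h x)%:E)%E.
Proof.
have E w : ((td_sum n w)%:E = \sum_(t < n) (gamma ^+ t)%:E * (td t w)%:E)%E.
  by rewrite /td_sum -sumEFin; apply: eq_bigr => t _; rewrite EFinM.
have -> : (fun w => (td_sum n w)%:E) =
    (fun w => \sum_(t < n) (gamma ^+ t)%:E * (td t w)%:E)%E by exact/funext.
have int1 (t : 'I_n) : Q.-integrable setT
    (fun w => ((gamma ^+ t)%:E * (td t w)%:E)%E).
  by apply: integrableZl => //; case: (integral_td t).
split; first by apply: integrable_sum => // t _.
rewrite integral_sum// -sumEFin; apply: eq_bigr => t _.
by have [it et] := integral_td t; rewrite integralZl// et EFinM.
Qed.

Lemma integral_start :
  Q.-integrable setT (fun w => (u (X 0 w))%:E) /\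
  (\int[Q]_w (u (X 0 w))%:E = (u s)%:E)%E.
Proof.
have [mX _ start _ _] := traj.
have [iu ->] := integral_finite_valued Q u (mX 0); split=> //.
rewrite (bigD1 s)//= start mulr1 big1 ?addr0// => x xs.
suff -> : Q [set w | X 0 w = x] = 0%E by rewrite mulr0.
apply/eqP; rewrite eq_le measure_ge0 andbT.
have out : Q (~` [set w | X 0 w = s]) = 0%E.
  by rewrite probability_setC// start subee.
rewrite -out; apply: le_measure; rewrite ?inE//; first exact: measurableC.
by move=> w /= -> xs'; rewrite xs' eqxx in xs.
Qed.

(** Integrate [td_sum_telescope]: the boundary term gamma^n u(X_n) disappears in
the limit, and dominated convergence applies because the increments are
bounded. What remains is the discounted sum of the mean residuals, so that
their sign decides on which side of u s the expected return lies. *)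
Lemma expected_return_cvg :
  ('E_Q[discounted_return X Y r gamma] \is a fin_num)%E /\
  ((\sum_(t < n) gamma ^+ t *
    \sum_(h : t.-tuple (S * A)) \sum_x occupation t h x * residual h x)%:E
  @[n --> \oo] --> ('E_Q[discounted_return X Y r gamma] - (u s)%:E)%E).
Proof.
have [iu u0] := integral_start.
set K := (Kr + gamma * Ku + Ku) / (1 - gamma).
pose f w := (discounted_return X Y r gamma w - u (X 0 w))%:E.
have cf w : (td_sum n w)%:E @[n --> \oo] --> f w.
  by apply: cvg_EFin; [exact: nearW|exact: td_sum_cvg].
have mtd n := measurable_int _ (integral_td_sum n).1.
have mf := measurable_realfun.emeasurable_fun_cvg
  (fun n w => (td_sum n w)%:E) f mtd (fun w _ => cf w).
have iK : Q.-integrable setT (cst K%:E) by exact: finite_measure_integrable_cst.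
have [] := @dominated_convergence _ _ _ Q setT measurableT
  (fun n w => (td_sum n w)%:E) f (cst K%:E) mtd mf _ iK _.
- by apply: aeW => w _; exact: cf.
- by apply: aeW => w n _; rewrite lee_fin td_sum_bound.
move=> intf _ itd.
have -> : ('E_Q[discounted_return X Y r gamma] =
    \int[Q]_w f w + (u s)%:E)%E.
  rewrite unlock -u0 -integralD//; apply: eq_integral => w _.
  by rewrite /f -EFinD subrK.
rewrite addeK//; split.
  rewrite fin_numD; apply/andP; split => //.
  exact: (integrable_fin_num measurableT intf).
apply: cvg_trans; last exact: itd.
apply: near_eq_cvg; apply: nearW => n /=.
by rewrite (integral_td_sum n).2.
Qed.

Lemma expected_return_le : (forall h x, residual h x <= 0) ->
  ('E_Q[discounted_return X Y r gamma] <= (u s)%:E)%E.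
Proof.
move=> res0; rewrite -sube_le0.
have [_ cv] := expected_return_cvg; apply: cvge_le cv; apply: nearW => n.
rewrite lee_fin; apply: sumr_le0 => t _; apply: mulr_ge0_le0.
  exact: exprn_ge0.
apply: sumr_le0 => h _; apply: sumr_le0 => x _.
by apply: mulr_ge0_le0; first exact: occupation_ge0.
Qed.

Lemma expected_return_eq : (forall h x, residual h x = 0) ->
  ('E_Q[discounted_return X Y r gamma] = (u s)%:E)%E.
Proof.
move=> res0; apply/eqP; rewrite eq_le expected_return_le/=; last first.
  by move=> h x; rewrite res0.
have [_ cv] := expected_return_cvg.
rewrite -sube_ge0//; apply: cvge_ge cv; apply: nearW => n.
rewrite big1// => t _; rewrite big1 ?mulr0// => h _.
by rewrite big1// => x _; rewrite res0 mulr0.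
Qed.

End Return.

(** * Random words with prescribed conditional laws *)

Definition uniform01 (R : realType) :
    probability (measurableTypeR R) R := uniform_prob (@ltr01 R).

Section WordProcess.
Context {R : realType} {E : finType} (e0 : E).
Variable q : seq E -> E -> R.
Hypothesis simplex_q : forall h, simplex (q h).

Definition word_prob (h : seq E) : R :=
  \prod_(i < size h) q (take i h) (nth e0 h i).

Definition cumul (h : seq E) (k : nat) : R :=
  \sum_(0 <= i < k) q h (nth e0 (enum E) i).

Definition word_start (h : seq E) : R :=
  \sum_(i < size h)
    word_prob (take i h) * cumul (take i h) (index (nth e0 h i) (enum E)).

(** The intervals of the words [rcons h e] partition that of h from left to
right, in the order of [enum E], proportionally to q h e. A single uniform point
w of [0, 1[ then carries the randomness of a whole process: the one that spells
the words whose intervals contain w. *)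
Definition word_itv (h : seq E) : set R :=
  [set` `[word_start h, word_start h + word_prob h[%R].

Lemma word_prob_rcons h e : word_prob (rcons h e) = word_prob h * q h e.
Proof.
rewrite /word_prob size_rcons big_ord_recr/=; congr (_ * _).
  apply: eq_bigr => i _.
  by rewrite nth_rcons ltn_ord -cats1 takel_cat// ltnW.
by rewrite nth_rcons ltnn eqxx -cats1 take_size_cat.
Qed.

Lemma word_start_rcons h e : word_start (rcons h e) =
  word_start h + word_prob h * cumul h (index e (enum E)).
Proof.
rewrite /word_start size_rcons big_ord_recr/=; congr (_ + _).
  apply: eq_bigr => i _.
  by rewrite nth_rcons ltn_ord -cats1 takel_cat// ltnW.
by rewrite nth_rcons ltnn eqxx -cats1 take_size_cat.
Qed.

Lemma word_prob_ge0 h : 0 <= word_prob h.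
Proof. by apply: prodr_ge0 => i _; case: (simplex_q (take i h)). Qed.

Lemma cumulS h k : cumul h k.+1 = cumul h k + q h (nth e0 (enum E) k).
Proof. by rewrite /cumul big_nat_recr. Qed.

Lemma cumul_total h : cumul h #|E| = 1.
Proof.
have [_ <-] := simplex_q h; rewrite /cumul cardE -(big_nth e0 xpredT).
by rewrite big_enum.
Qed.

Lemma le_cumul h : {homo cumul h : i j / (i <= j)%N >-> i <= j}.
Proof.
apply: homo_leq => [//|x y z|k]; first exact: le_trans.
by rewrite cumulS lerDl; case: (simplex_q h).
Qed.

Lemma cumul_ge0 h k : 0 <= cumul h k.
Proof. by apply: sumr_ge0 => i _; case: (simplex_q h). Qed.

Lemma cumul_le1 h k : (k <= #|E|)%N -> cumul h k <= 1.
Proof. by move=> kE; rewrite -(cumul_total h) le_cumul. Qed.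

Lemma word_itv_rcons h e w : word_itv (rcons h e) w <->
  word_start h + word_prob h * cumul h (index e (enum E)) <= w <
  word_start h + word_prob h * cumul h (index e (enum E)).+1.
Proof.
rewrite /word_itv/= in_itv/= word_start_rcons word_prob_rcons -addrA -mulrDr.
by rewrite cumulS nth_index ?mem_enum.
Qed.

Lemma index_enum_lt (e : E) : (index e (enum E) < #|E|)%N.
Proof. by rewrite cardE index_mem mem_enum. Qed.

Lemma word_itv_prefix h e : word_itv (rcons h e) `<=` word_itv h.
Proof.
move=> w /word_itv_rcons/andP[w1 w2]; rewrite /word_itv/= in_itv/=.
have p0 := word_prob_ge0 h.
have c0 : 0 <= word_prob h * cumul h (index e (enum E)).
  by rewrite mulr_ge0 ?cumul_ge0.
have c1 : word_prob h * cumul h (index e (enum E)).+1 <= word_prob h.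
  by rewrite ler_piMr// cumul_le1// index_enum_lt.
by apply/andP; split; lra.
Qed.

Lemma word_itv_disjoint h e e' w :
  word_itv (rcons h e) w -> word_itv (rcons h e') w -> e = e'.
Proof.
wlog : e e' / (index e (enum E) <= index e' (enum E))%N.
  move=> th; case/orP: (leq_total (index e (enum E)) (index e' (enum E))).
    exact: th.
  by move=> ee' we we'; apply/esym/th.
rewrite leq_eqVlt => /predU1P[ee' _ _|lt_ee'].
  by rewrite -[e](nth_index e0 (mem_enum _ _))// ee' nth_index ?mem_enum.
move=> /word_itv_rcons/andP[_ w1] /word_itv_rcons/andP[w2 _]; exfalso.
have := ler_wpM2l (word_prob_ge0 h) (le_cumul h lt_ee'); lra.
Qed.

(** Scan the subintervals from left to right until w is passed. *)
Lemma word_itv_cover h w : word_itv h w -> exists e, word_itv (rcons h e) w.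
Proof.
rewrite /word_itv/= in_itv/= => /andP[w0 w1].
suff cover k : (k <= #|E|)%N -> w < word_start h + word_prob h * cumul h k ->
    exists e, word_itv (rcons h e) w.
  by apply: (cover #|E|) => //; rewrite cumul_total mulr1.
elim: k => [_|k IHk kE wk]; first by rewrite /cumul big_geq// mulr0 addr0; lra.
have [|wk'] := ltP w (word_start h + word_prob h * cumul h k).
  exact/IHk/ltnW.
exists (nth e0 (enum E) k); apply/word_itv_rcons.
by rewrite index_uniq ?enum_uniq -?cardE// wk'.
Qed.

(** The default letter e0 is only used for points w outside [0, 1[. *)
Fixpoint word (t : nat) (w : R) : seq E :=
  if t is t'.+1 then
    rcons (word t' w) (odflt e0 [pick e | w \in word_itv (rcons (word t' w) e)])
  else [::].

Definition letter t w : E :=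
  odflt e0 [pick e | w \in word_itv (rcons (word t w) e)].

Lemma size_word t w : size (word t w) = t.
Proof. by elim: t => //= t IHt; rewrite size_rcons IHt. Qed.

Lemma mkseq_letter t w : mkseq (letter ^~ w) t = word t w.
Proof. by elim: t => //= t IHt; rewrite mkseqS IHt. Qed.

Lemma word_itv_nil : word_itv [::] = [set` `[0, 1[%R].
Proof. by rewrite /word_itv /word_start /word_prob !big_ord0 add0r. Qed.

Lemma word_itv_sub h : word_itv h `<=` word_itv [::].
Proof.
elim/last_ind: h => [//|h e IHh]; apply: subset_trans IHh.
exact: word_itv_prefix.
Qed.

Lemma mem_word_itv t w : word_itv [::] w -> word_itv (word t w) w.
Proof.
move=> w01; elim: t => //= t /word_itv_cover[e he]; case: pickP => [e'|].
  by rewrite inE.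
by move=> /(_ e); rewrite mem_set.
Qed.

Lemma word_eq h w : word_itv h w -> word (size h) w = h.
Proof.
elim/last_ind: h => [//|h e IHh] he; rewrite size_rcons/= IHh; last first.
  exact: word_itv_prefix he.
case: pickP => [e'|/(_ e)]; last by rewrite mem_set.
by rewrite inE => he'; rewrite (word_itv_disjoint he he').
Qed.

Lemma word_out t w : ~ word_itv [::] w -> word t w = nseq t e0.
Proof.
move=> wN; elim: t => //= t ->; case: pickP => [e|_].
  by rewrite inE => /word_itv_sub.
by rewrite -cats1 /= cat_nseq /ncons -iterSr.
Qed.

(** Outside [0, 1[ the word is constantly e0, which adds a null set to the
preimage of one word of each length. *)
Lemma word_preimage h : [set w | word (size h) w = h] =
  word_itv h `|` (if h == nseq (size h) e0 then ~` word_itv [::] else set0).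
Proof.
apply/seteqP; split => w /=.
  have [w01|wN] := pselect (word_itv [::] w) => wh.
    by left; rewrite -wh; exact: mem_word_itv.
  by right; rewrite -[X in X == _]wh word_out// eqxx.
case; first exact: word_eq.
by case: eqP => [h0 wN|_ []]; rewrite word_out.
Qed.

Lemma measurable_word_itv h : measurable (word_itv h).
Proof. exact: measurable_itv. Qed.

Lemma measurable_word t h : measurable [set w | word t w = h].
Proof.
have [<-|th] := eqVneq (size h) t; last first.
  rewrite (_ : [set w | _] = set0)//; apply/seteqP; split => // w /= wh.
  by move: th; rewrite -wh size_word eqxx.
rewrite word_preimage; apply: measurableU; first exact: measurable_word_itv.
by case: ifP => // _; apply: measurableC; exact: measurable_word_itv.
Qed.

Lemma measurable_letter t e : measurable [set w | letter t w = e].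
Proof.
rewrite (_ : [set w | _] = \bigcup_(h in [set: t.-tuple E])
    [set w | word t.+1 w = rcons h e]).
  apply: fin_bigcup_measurable => [|h _]; first exact: finite_finset.
  exact: measurable_word.
apply/seteqP; split => w /=.
  have st : size (word t w) == t by rewrite size_word.
  by move=> <-; exists (Tuple st).
by move=> [h _ /rcons_inj[_ <-]].
Qed.

Lemma uniform_word_itv h :
  uniform01 R (word_itv h) = (word_prob h)%:E.
Proof.
have sub01 : word_itv h `<=` `[0, 1]%classic.
  apply: subset_trans (@word_itv_sub h) _; rewrite word_itv_nil => w /=.
  by rewrite !in_itv/= => /andP[-> /ltW].
rewrite -[LHS]/(uniform_prob (@ltr01 R) (word_itv h)).
rewrite /uniform_prob integral_uniform_pdf setIidl//.
rewrite (eq_integral (fun=> 1%E)); last first.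
  move=> w /set_mem/sub01/=; rewrite in_itv/= /uniform_pdf => ->.
  by rewrite subr0 invr1.
rewrite integral_cst ?mul1e; last exact: measurable_word_itv.
rewrite -[LHS]/(lebesgue_measure (word_itv h)).
rewrite /word_itv lebesgue_measure_itv/= lte_fin ltrDl.
case: ltP => [_|p0]; first by rewrite -EFinB addrAC subrr add0r.
by congr (_%:E); apply/le_anti; rewrite p0 word_prob_ge0.
Qed.

Lemma uniform_word h :
  uniform01 R [set w | word (size h) w = h] = (word_prob h)%:E.
Proof.
have m0 := measurable_word_itv [::].
have out0 : uniform01 R (~` word_itv [::]) = 0%E.
  rewrite probability_setC// uniform_word_itv /word_prob big_ord0.
  by rewrite subee.
have mif :
    measurable (if h == nseq (size h) e0 then ~` word_itv [::] else set0).
  by case: ifP => // _; exact: measurableC.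
set B := (X in measurable X) in mif.
have IB0 : word_itv h `&` B = set0.
  rewrite /B; case: ifP => _; last by rewrite setI0.
  by apply/disjoints_subset; rewrite setCK; exact: word_itv_sub.
have UB : uniform01 R (word_itv h `|` B) =
    (uniform01 R (word_itv h) + uniform01 R B)%E.
  by apply: (@measureU _ _ _ (uniform01 R)) => //; exact: measurable_word_itv.
rewrite word_preimage -/B UB uniform_word_itv /B.
by case: ifP => _; rewrite ?out0 ?measure0 adde0.
Qed.

End WordProcess.

Lemma word_process_exists {R : realType} {E : finType} (e0 : E)
    (q : seq E -> E -> R) : (forall h, simplex (q h)) ->
  exists (d : measure_display) (Omega : measurableType d)
    (Q : probability Omega R) (Z : nat -> Omega -> E),
  (forall t e, measurable [set w | Z t w = e]) /\
  (forall h, Q [set w | mkseq (Z ^~ w) (size h) = h] =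
     (word_prob e0 q h)%:E).
Proof.
move=> sq; exists _, _, (uniform01 R), (letter e0 q); split.
  exact: measurable_letter.
move=> h; under eq_set do rewrite mkseq_letter.
exact: uniform_word.
Qed.

(** * Existence of trajectories *)

Section TrajectoryExistence.
Context {R : realType} {S A : finType}.
Variables (pi : @policy R S A) (P : transition R S A) (s : S).
Hypotheses (spi : history_policies pi) (tP : transitions P).

Definition next_state (h : seq (S * A)) (x : S) : R :=
  if h is e :: h' then P (last e h').1 (last e h').2 x else (x == s)%:R.

Definition step_law (h : seq (S * A)) (e : S * A) : R :=
  next_state h e.1 * pi h e.1 e.2.

Lemma next_state_rcons h x a x' : next_state (rcons h (x, a)) x' = P x a x'.
Proof. by case: h => //= e h; rewrite last_rcons. Qed.

Lemma simplex_next_state h : simplex (next_state h).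
Proof.
case: h => [|e h] /=; last exact: tP.
split => [x|]; first by rewrite ler0n.
by rewrite (bigD1 s)//= eqxx big1 ?addr0// => x /negbTE ->.
Qed.

Lemma simplex_step_law h : simplex (step_law h).
Proof.
have [n0 n1] := simplex_next_state h; split => [[x a]|].
  by have [p0 _] := spi h x; exact: mulr_ge0.
rewrite -n1 sum_prod; apply: eq_bigr => x _.
by have [_ p1] := spi h x; rewrite /step_law/= -mulr_sumr p1 mulr1.
Qed.

(** A word process on S * A with letters drawn from [step_law]. A letter is a
state and an action together, so that the law of the state alone, given the
history, is recovered by summing over the actions. *)
Lemma trajectory_exists (a0 : A) :
  exists (d : measure_display) (Omega : measurableType d)
    (Q : probability Omega R) (X : nat -> Omega -> S) (Y : nat -> Omega -> A),
    is_trajectory pi P s Q X Y.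
Proof.
have [d [T [Q [Z [mZ lawZ]]]]] :=
  word_process_exists (s, a0) simplex_step_law.
pose X t w := (Z t w).1; pose Y t w := (Z t w).2.
have pastE t w : past X Y t w = mkseq (Z ^~ w) t.
  by apply: eq_mkseq => i; rewrite /X /Y -surjective_pairing.
have mX t x : measurable [set w | X t w = x].
  rewrite (_ : [set w | _] = \bigcup_(a in [set: A]) [set w | Z t w = (x, a)]).
    by apply: fin_bigcup_measurable => //; exact: finite_finset.
  apply/seteqP; split => w /=; last by move=> [a _]; rewrite /X => ->.
  by move=> <-; exists (Y t w) => //=; rewrite -surjective_pairing.
have mY t a : measurable [set w | Y t w = a].
  rewrite (_ : [set w | _] = \bigcup_(x in [set: S]) [set w | Z t w = (x, a)]).
    by apply: fin_bigcup_measurable => //; exact: finite_finset.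
  apply/seteqP; split => w /=; last by move=> [x _]; rewrite /Y => ->.
  by move=> <-; exists (X t w) => //=; rewrite -surjective_pairing.
pose p := word_prob (s, a0) step_law.
have size_past t h w : past X Y t w = h -> size h = t.
  by move=> <-; rewrite size_mkseq.
have law_XY h x a : Q [set w | [/\ past X Y (size h) w = h,
    X (size h) w = x & Y (size h) w = a]] = (p (rcons h (x, a)))%:E.
  rewrite -lawZ size_rcons; congr (Q _); apply/seteqP; split => w /=.
    rewrite pastE mkseqS => -[-> <- <-].
    by rewrite -surjective_pairing.
  rewrite pastE mkseqS => /rcons_inj[hw Zw].
  by rewrite /X /Y Zw.
have law_X h x : Q [set w | past X Y (size h) w = h /\ X (size h) w = x] =
    (p h * next_state h x)%:E.
  have mhx := measurable_past_state mX mY (size h) h x.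
  rewrite (measure_fibers Q mhx (mY (size h))).
  rewrite (eq_bigr (fun a => (p h * next_state h x * pi h x a)%:E)).
    by rewrite sumEFin -mulr_sumr; have [_ ->] := spi h x; rewrite mulr1.
  move=> a _; rewrite -mulrA -[_ * pi h x a]/(step_law h (x, a)).
  rewrite -word_prob_rcons -/p -law_XY; congr (Q _).
  by apply/seteqP; split => w /= => [[[]]|[]].
have null t (B : set T) h : size h != t ->
    B `<=` [set w | past X Y t w = h] -> Q B = 0%E.
  move=> ht sub; rewrite (_ : B = set0) ?measure0//.
  apply/seteqP; split => // w /sub/size_past hw.
  by rewrite hw eqxx in ht.
exists d, T, Q, X, Y; split=> //.
- have := law_X [::] s; rewrite /p /word_prob big_ord0 /= eqxx mulr1.
  by move=> <-; congr (Q _); apply/seteqP; split => w /= => [|[]].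
- move=> t h x a; have [<-|ht] := eqVneq (size h) t.
    by rewrite law_XY law_X /p word_prob_rcons /step_law/= mulrA EFinM.
  rewrite (null t _ h ht) ?(null t [set w | _ /\ _] h ht) ?mul0e//.
    by move=> w [].
  by move=> w [].
- move=> t h x a x'; have [<-|ht] := eqVneq (size h) t; last first.
    rewrite (null t _ h ht) ?(null t [set w | [/\ _, _ & _]] h ht) ?mul0e//.
      by move=> w [].
    by move=> w [].
  rewrite law_XY -(next_state_rcons h) -EFinM -law_X size_rcons.
  congr (Q _); apply/seteqP; split => w /=; rewrite pastS.
    by move=> [-> -> -> ->].
  by move=> [/rcons_inj[-> -> ->] ->].
Qed.

End TrajectoryExistence.

(** * The value of a policy *)

Section Value.
Context {R : realType} {S A : finType}.
Variables (r : S -> A -> R) (gamma : R).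
Hypotheses (A0 : (0 < #|A|)%N) (g0 : 0 <= gamma) (g1 : gamma < 1).
Implicit Types (P : transition R S A) (u : S -> R).

(** The set from which [value] selects is nonempty: a trajectory exists and its
expected return is finite. *)
Lemma value_expectation (pi : policy) P s :
  history_policies pi -> transitions P ->
  exists (d : measure_display) (T : measurableType d)
    (Q : probability T R) (X : nat -> T -> S) (Y : nat -> T -> A),
    is_trajectory pi P s Q X Y /\
    ((value r gamma pi P s)%:E = 'E_Q[discounted_return X Y r gamma])%E.
Proof.
move=> spi tP; have [a0 _] := card_gt0P A0.
have [d [T [Q [X [Y traj]]]]] := trajectory_exists s spi tP a0.
have [fin _] := expected_return_cvg traj spi tP r (fun=> 0) g0 g1.
apply: (@xgetPex _ 0 [set v | exists (d : measure_display)
  (T : measurableType d) (Q : probability T R) (X : nat -> T -> S)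
  (Y : nat -> T -> A), is_trajectory pi P s Q X Y /\
  (v%:E = 'E_Q[discounted_return X Y r gamma])%E]).
exists (fine ('E_Q[discounted_return X Y r gamma])%E).
by exists d, T, Q, X, Y; rewrite fineK.
Qed.

(** The residuals of u are nonpositive after every history, so memory does not
help pi. *)
Lemma value_le (pi : policy) P u : history_policies pi -> transitions P ->
  (forall h x, backup r gamma u x P (pi h x) <= u x) ->
  forall s, value r gamma pi P s <= u s.
Proof.
move=> spi tP le_u s.
have [d [T [Q [X [Y [traj E]]]]]] := value_expectation s spi tP.
rewrite -lee_fin E; apply: (expected_return_le traj) => // h x.
by rewrite subr_le0; exact: le_u.
Qed.

Lemma value_stationary (pi : S -> A -> R) P u :
  stationary_policies pi -> transitions P ->
  (forall x, backup r gamma u x P (pi x) = u x) ->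
  value r gamma (policy_of_stationary pi) P = u.
Proof.
move=> spi tP eq_u; apply/funext => s.
have hpi : history_policies (policy_of_stationary pi).
  by move=> h x; exact: spi.
have [d [T [Q [X [Y [traj E]]]]]] := value_expectation s hpi tP.
apply: EFin_inj; rewrite E; apply: (expected_return_eq traj) => // h x.
by apply/eqP; rewrite subr_eq0; apply/eqP; exact: eq_u.
Qed.

Lemma value_backup (pi : S -> A -> R) P :
  stationary_policies pi -> transitions P ->
  let v := value r gamma (policy_of_stationary pi) P in
  forall s, backup r gamma v s P (pi s) = v s.
Proof.
move=> spi tP v.
have g01 : 0 <= gamma < 1 by rewrite g0.
have [u eq_u] := discounted_fixpoint g01 (discounted_backup r g0 tP spi).
by rewrite /v (value_stationary spi tP eq_u).
Qed.

End Value.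

(** * Consequences of weak s-tractability *)

Section Robust.
Context {R : realType} {S A : finType}.
Variables (U : set (transition R S A)) (gamma : R).
Hypotheses (S0 : (0 < #|S|)%N) (A0 : (0 < #|A|)%N).
Hypotheses (tU : U `<=` transitions) (U0 : U !=set0) (cU : compact U).
Hypotheses (g0 : 0 <= gamma) (g1 : gamma < 1).

Lemma robust_value_eq r (pi : S -> A -> R) u : stationary_policies pi ->
  (forall s, robust_backup U r gamma u s (pi s) = u s) ->
  robust_value U r gamma pi = u.
Proof.
move=> spi eq_u.
have dF := discounted_robust_backup r tU U0 cU g0 spi.
apply: xget_unique => [s|v hv].
  by rewrite -eq_u; exact: robust_backup_min.
have eq_v s : robust_backup U r gamma v s (pi s) = v s.
  exact: (is_min_inf (hv s)).
apply/funext => s; apply/le_anti/andP; split.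
  by apply: (discounted_comparison g1 dF) => x; rewrite ?eq_u ?eq_v.
by apply: (discounted_comparison g1 dF) => x; rewrite ?eq_u ?eq_v.
Qed.

(** The value is a fixed point of the backup under P, which dominates the robust
backup; the comparison principle concludes. *)
Lemma value_ge_robust r (pi : S -> A -> R) P u : stationary_policies pi ->
  U P -> (forall s, robust_backup U r gamma u s (pi s) = u s) ->
  forall s, u s <= value r gamma (policy_of_stationary pi) P s.
Proof.
move=> spi UP eq_u; have tP := tU UP.
apply: (discounted_comparison g1 (discounted_backup r g0 tP spi)) => s.
  by rewrite -{1}eq_u; exact: robust_backup_le.
by rewrite value_backup.
Qed.

(** The only use of weak s-tractability with a reward other than r. The reward
r' = r + c makes u the robust value of pi, so that some P in U gives
mu . v = mu . u for the uniform mu. Since v >= u in every coordinate, v = u, and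
the fixed-point equation of v under P says that P attains all the minima. *)
Lemma simultaneous_minimizer (pi : S -> A -> R) r u :
  weakly_s_tractable U -> stationary_policies pi ->
  exists2 P, U P & forall s,
    backup r gamma u s P (pi s) = robust_backup U r gamma u s (pi s).
Proof.
move=> wt spi.
pose c s := u s - robust_backup U r gamma u s (pi s).
pose r' s a := r s a + c s.
have backup' P s : backup r' gamma u s P (pi s) =
    backup r gamma u s P (pi s) + c s.
  have [_ p1] := spi s; rewrite -[c s in RHS]mul1r -p1 mulr_suml -big_split/=.
  by apply: eq_bigr => a _; rewrite /r' addrAC mulrDr.
have eq_u s : robust_backup U r' gamma u s (pi s) = u s.
  have [P UP eP] := robust_backup_attained r gamma u s (pi s) cU U0.
  apply: is_min_inf; split.
    by exists P => //; rewrite backup' -eP /c addrC subrK.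
  move=> _ [P' UP' <-]; rewrite backup' /c addrCA lerDl subr_ge0.
  exact: robust_backup_le.
pose mu : S -> R := fun=> #|S|%:R^-1.
have mu0 s : 0 < mu s by rewrite invr_gt0 ltr0n.
have smu : simplex mu.
  split=> [s|]; first exact: ltW.
  by rewrite sumr_const -[LHS]mulr_natr mulVf// pnatr_eq0 -lt0n.
have g01 : 0 <= gamma < 1 by rewrite g0.
have [[P UP eqP] _] := wt pi r' gamma mu spi g01 smu.
rewrite (robust_value_eq spi eq_u) in eqP.
have ge_u := value_ge_robust spi UP eq_u.
have vu s : value r' gamma (policy_of_stationary pi) P s = u s.
  move: eqP => /eqP; rewrite /dot -subr_eq0 -sumrB psumr_eq0.
    move=> /allP/(_ s (mem_index_enum s)); rewrite -mulrBr mulf_eq0 gt_eqF//=.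
    by rewrite subr_eq0 => /eqP.
  by move=> x _; rewrite -mulrBr mulr_ge0 ?subr_ge0 ?ge_u// ltW.
exists P => // s.
have := value_backup r' A0 g0 g1 spi (tU UP) s.
by rewrite (funext vu) backup' /c; lra.
Qed.

(** By [convex_alternative], it suffices to find, for nonnegative weights l on
the pairs (s, a), some P in U for which the weighted sum of the excesses of the
backups over u is nonpositive. Normalizing l at each state gives a stationary
policy, and [simultaneous_minimizer] gives P. *)
Lemma dominating_transition r u : weakly_s_tractable U ->
  convex_set (U : set (S -> A -> S -> R^o)) ->
  (forall (pi : S -> A -> R), stationary_policies pi ->
    forall s, robust_backup U r gamma u s (pi s) <= u s) ->
  exists2 P, U P & forall s p, simplex p -> backup r gamma u s P p <= u s.
Proof.
move=> wt convU ub.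
pose g (i : S * A) (P : transition R S A) : R :=
  r i.1 i.2 + gamma * dot (P i.1 i.2) u - u i.1.
have cg i : continuous (g i).
  have cs := @continuous_backup R S A r gamma u i.1 (fun a => (a == i.2)%:R).
  rewrite (_ : g i = fun P => - u i.1 + backup r gamma u i.1 P
    (fun a => (a == i.2)%:R)); first exact: continuous_shift.
  apply/funext => P; rewrite /g /backup (bigD1 i.2)//= eqxx mul1r.
  rewrite big1 => [|a /negbTE ->]; last by rewrite mul0r.
  by rewrite addr0 addrC.
have mix x y t : U x -> U y -> 0 <= t <= 1 ->
    exists2 z, U z & forall i, g i z = t * g i x + (1 - t) * g i y.
  move=> Ux Uy t01.
  have [z Uz gz] : exists2 z, U z & forall s a e,
    z s a e = t * x s a e + (1 - t) * y s a e.
    have [t0 t1] := andP t01.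
    have := convU x y (Itv01 t0 t1) (mem_set Ux) (mem_set Uy).
    by move=> /set_mem Uz; eexists; first exact: Uz.
  exists z => // i; rewrite /g /dot.
  under eq_bigr do rewrite gz mulrDl -!mulrA.
  by rewrite big_split/= -!mulr_sumr; ring.
have alt (l : S * A -> R) : (forall i, 0 <= l i) ->
    exists2 P, U P & \sum_i l i * g i P <= 0.
  move=> l0.
  pose L s := \sum_a l (s, a).
  have [p0 sp0] := simplex_nonempty R A0.
  (* At states of weight 0 any law of the actions does. *)
  pose pi s a := if L s == 0 then p0 a else l (s, a) / L s.
  have L0 s : 0 <= L s by exact: sumr_ge0.
  have piE s a : L s * pi s a = l (s, a).
    rewrite /pi; case: eqP => [Ls|/eqP Ls]; last by rewrite mulrC divfK.
    move: (Ls) => /eqP; rewrite psumr_eq0// => /allP/(_ a (mem_index_enum a)).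
    by rewrite /= Ls mul0r => /eqP ->.
  have spi : stationary_policies pi.
    move=> s; rewrite /pi; case: eqP => [//|/eqP Ls].
    split => [a|]; first by rewrite divr_ge0.
    by rewrite -mulr_suml divff.
  have [P UP minP] := simultaneous_minimizer r u wt spi.
  exists P => //; rewrite sum_prod; apply: sumr_le0 => s _.
  have -> : \sum_a l (s, a) * g (s, a) P =
      L s * (backup r gamma u s P (pi s) - u s).
    have [_ p1] := spi s.
    rewrite /backup -[X in _ - X]mul1r -p1 [X in _ - X]mulr_suml.
    rewrite -sumrB mulr_sumr.
    by apply: eq_bigr => a _; rewrite -piE -mulrBr mulrA.
  by rewrite mulr_ge0_le0// subr_le0 minP ub.
have [P UP gP] := convex_alternative cU U0 cg mix alt.
exists P => // s p [p0 p1]; rewrite -[u s]mul1r -p1 mulr_suml.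
apply: ler_sum => a _; apply: ler_wpM2l => //.
by have := gP (s, a); rewrite subr_le0.
Qed.

End Robust.

(** * Stationary optimal policies *)

Theorem theorem7 (R : realType) (S A : finType)
    (U : set (transition R S A)) (r : S -> A -> R) (gamma : R) :
  (0 < #|S|)%N -> (0 < #|A|)%N ->
  U `<=` transitions ->
  U !=set0 ->
  compact U ->
  convex_set (U : set (S -> A -> S -> R^o)) ->
  weakly_s_tractable U ->
  0 < gamma < 1 ->
  (forall mu : S -> R, simplex mu ->
    (forall pi : S -> A -> R, stationary_policies pi ->
      exists m, is_min
        [set dot mu (value r gamma (policy_of_stationary pi) P) | P in U] m) /\
    exists M : R,
      is_max [set m | exists2 pi : S -> A -> R, stationary_policies pi &
        is_min [set dot mu (value r gamma (policy_of_stationary pi) P)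
               | P in U] m] M /\
      optimal_value U r gamma mu = M%:E) /\
  (exists2 pi : S -> A -> R, stationary_policies pi &
    forall mu : S -> R, simplex mu ->
      worst_case U r gamma mu (policy_of_stationary pi) =
      optimal_value U r gamma mu).
Proof.
move=> S0 A0 tU U0 cU convU wt /andP[/ltW g0 g1].
have g01 : 0 <= gamma < 1 by rewrite g0.
have [u fix_u] := discounted_fixpoint g01
  (discounted_optimal_backup r tU U0 cU g0 A0).
have /choice[pi hpi] : forall s, exists p, simplex p /\
    robust_backup U r gamma u s p = u s.
  move=> s; have [[p sp eqp] _] := optimal_backup_max r tU U0 cU g0 A0 u s.
  by exists p; rewrite eqp fix_u.
have spi : stationary_policies pi by move=> s; case: (hpi s).
have eq_u s : robust_backup U r gamma u s (pi s) = u s by case: (hpi s).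
have ub_u (pi' : S -> A -> R) : stationary_policies pi' ->
    forall s, robust_backup U r gamma u s (pi' s) <= u s.
  move=> spi' s; rewrite -[leRHS]fix_u.
  by have [_] := optimal_backup_max r tU U0 cU g0 A0 u s; apply; exact: spi'.
have [P UP domP] := dominating_transition S0 A0 tU U0 cU g0 g1 wt convU ub_u.
have le_dot mu (v w : S -> R) : simplex mu -> (forall s, v s <= w s) ->
    dot mu v <= dot mu w.
  by move=> [mu0 _] vw; apply: ler_sum => s _; rewrite ler_wpM2l.
have worst_le mu (pi' : policy) : simplex mu -> history_policies pi' ->
    dot mu (value r gamma pi' P) <= dot mu u.
  move=> smu spi'; apply: le_dot => //; apply: value_le => //; first exact: tU.
  by move=> h x; apply: domP; exact: spi'.
have min_pi mu : simplex mu ->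
    is_min [set dot mu (value r gamma (policy_of_stationary pi) P) | P in U]
      (dot mu u).
  move=> smu; have := wt pi r gamma mu spi g01 smu.
  by rewrite (robust_value_eq tU U0 cU g0 g1 spi eq_u).
have hstat (pi' : S -> A -> R) : stationary_policies pi' ->
  history_policies (policy_of_stationary pi') by move=> spi' h s; exact: spi'.
have worst_pi mu : simplex mu ->
    worst_case U r gamma mu (policy_of_stationary pi) = (dot mu u)%:E.
  move=> smu; have [[P' UP' eqP'] lb] := min_pi _ smu.
  apply/le_anti/andP; split.
    by apply: ereal_inf_lbound; exists P' => //; rewrite eqP'.
  by apply/ereal_infP => _ [Q UQ <-]; rewrite lee_fin; apply: lb; exists Q.
have opt mu : simplex mu -> optimal_value U r gamma mu = (dot mu u)%:E.
  move=> smu; apply/le_anti/andP; split; last first.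
    rewrite -worst_pi//; apply: ereal_sup_ubound.
    by exists (policy_of_stationary pi) => //; exact: hstat.
  apply/ereal_supP => _ [pi' spi' <-].
  apply: (@le_trans _ _ (dot mu (value r gamma pi' P))%:E).
    by apply: ereal_inf_lbound; exists P.
  by rewrite lee_fin; exact: worst_le.
split; last by exists pi => // mu smu; rewrite worst_pi// opt.
move=> mu smu; split=> [pi' spi'|].
  by eexists; exact: wt spi' g01 smu.
exists (dot mu u); split; last exact: opt.
split; first by exists pi => //; exact: min_pi.
move=> m [pi' spi' [_ lbm]].
apply: (@le_trans _ _ (dot mu (value r gamma (policy_of_stationary pi') P))).
  by apply: lbm; exists P.
by apply: worst_le => //; exact: hstat.
Qed.
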